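(* (i) For every $l\ge 1$ and every fixed $2\times l$ $(0,1)$-matrix $F$, $\mathrm{fs}(m,F)\le m^{2+o(1)}$ as $m\to\infty$; that is, for every $\epsilon>0$ there exists $m_0=m_0(F,\epsilon)$ such that $\mathrm{fs}(m,F)\le m^{2+\epsilon}$ for all $m\ge m_0$. (ii) For every $k\ge 3$, every $l\ge 1$ and every fixed $k\times l$ $(0,1)$-matrix $F$, $\mathrm{fs}(m,F)\le m^{5k/3-1+o(1)}$ as $m\to\infty$; that is, for every $\epsilon>0$ there exists $m_0=m_0(F,\epsilon)$ such that $\mathrm{fs}(m,F)\le m^{5k/3-1+\epsilon}$ for all $m\ge m_0$.
   Context: All matrices have entries in $\{0,1\}$. A matrix $M$ contains a matrix $F$ if $F$ can be obtained from $M$ by deleting some (possibly no) rows and columns of $M$; the order of the remaining rows and columns is kept, and no entries are changed. A $(0,1)$-matrix is simple if its columns are pairwise distinct. For a $(0,1)$-matrix $F$, $\mathrm{fs}(m,F)$ denotes the maximal number of columns of a simple matrix with $m$ rows which does not contain $F$ (so $\mathrm{fs}(m,F)\le 2^m$). *)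

(* Defs.v *)
From mathcomp Require Import all_boot all_order all_algebra.

Set Implicit Arguments.
Unset Strict Implicit.
Unset Printing Implicit Defensive.

(* (0,1)-matrices are matrices over bool, which is a finType, so that the
   predicates below are decidable. *)

Definition strictly_increasing k m (f : {ffun 'I_k -> 'I_m}) : bool :=
  [forall i : 'I_k, forall j : 'I_k, (i < j) ==> (f i < f j)].

(* The maps f and g list the rows and columns of M that are kept. *)
Definition contains m n k l (M : 'M[bool]_(m, n)) (F : 'M[bool]_(k, l)) : bool :=
  [exists f : {ffun 'I_k -> 'I_m}, exists g : {ffun 'I_l -> 'I_n},
    [&& strictly_increasing f, strictly_increasing g & mxsub f g M == F]].

Definition simple m n (M : 'M[bool]_(m, n)) : bool :=
  injectiveb (fun j => col j M).

(* Bounding n by 2 ^ m loses nothing: see simple_le and fs_ge. *)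
Definition fs (m k l : nat) (F : 'M[bool]_(k, l)) : nat :=
  \max_(n < (2 ^ m).+1 |
        [exists M : 'M[bool]_(m, n), simple M && ~~ contains M F]) n.

Lemma simple_le m n (M : 'M[bool]_(m, n)) : simple M -> n <= 2 ^ m.
Proof.
move=> /injectiveP inj; have := leq_card _ inj.
by rewrite card_ord card_mx card_bool muln1.
Qed.

Lemma fs_ge m n k l (F : 'M[bool]_(k, l)) (M : 'M[bool]_(m, n)) :
  simple M -> ~~ contains M F -> n <= fs m F.
Proof.
move=> sM cM; have ltn : n < (2 ^ m).+1 by rewrite ltnS (simple_le sM).
apply: (@leq_bigmax_cond _ _ (fun i : 'I_(2 ^ m).+1 => i : nat) (Ordinal ltn)).
by apply/existsP; exists M; rewrite sM.
Qed.

Lemma fs_attained m k l (F : 'M[bool]_(k, l)) : 0 < l ->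
  exists M : 'M[bool]_(m, fs m F), simple M /\ ~~ contains M F.
Proof.
move=> l_gt0.
pose P (n : 'I_(2 ^ m).+1) :=
  [exists M : 'M[bool]_(m, n), simple M && ~~ contains M F].
have P0 : P ord0.
  apply/existsP; exists (const_mx false); apply/andP; split.
    by apply/injectiveP => -[].
  by apply/existsP => -[f /existsP[g _]]; case: (g (Ordinal l_gt0)).
have [n Pn eqn] : {n | P n & fs m F = n}.
  by apply: eq_bigmax_cond; apply/card_gt0P; exists ord0.
by rewrite eqn; have /existsP[M /andP[]] := Pn; exists M.
Qed.

(* Main.v *)
(* The proof gives the exponent 3k/2 - 1 for all k >= 2.

   If l consecutive blocks of columns of M shatter the same k-set of rows, then
   M contains F. Hence, if every block of about m^(k-1) columns shatters at
   least m^d k-sets, then M has at most about m^(k + k - 1 - d) columns; by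
   Sauer's lemma this holds with d = 0. The exponent d is improved step by step
   up to k/2. Suppose that a block shatters few k-sets. Deleting a row v loses
   only a family of columns that is separated by the other rows and whose
   shattered sets lie in the link of v in the hypergraph of shattered sets, so
   rows of low degree are deleted cheaply, by induction on k. The remaining rows
   are so few that the bound for the current d suffices for them; the number of
   k-sets that they shatter is controlled by a Kruskal-Katona type inequality.
   After n steps, d = k/2 - k/(2(n+1)). *)
Require Import Defs.
From mathcomp Require Import all_boot all_order all_algebra.
From mathcomp Require Import reals exp ring lra.

Set Implicit Arguments.
Unset Strict Implicit.
Unset Printing Implicit Defensive.

Import Order.TTheory GRing.Theory Num.Theory.
Local Open Scope ring_scope.

(** * Levels and links of set families *)

Section SetFamilies.
Variable T : finType.
Implicit Types (P Q : {set {set T}}) (S : {set T}) (v : T).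

Definition down_closed P := forall S S', S' \subset S -> S \in P -> S' \in P.
Definition level j P := [set S : {set T} in P | #|S| == j].
Definition link v P := [set S : {set T} | (v \notin S) && (v |: S \in P)].

Lemma levelS j P Q : P \subset Q -> level j P \subset level j Q.
Proof.
move=> PQ; apply/subsetP => S; rewrite !inE => /andP[SP ->].
by rewrite (subsetP PQ).
Qed.

Lemma link_sub v P : down_closed P -> link v P \subset P.
Proof.
move=> dP; apply/subsetP => S; rewrite inE => /andP[_].
exact/dP/subsetUr.
Qed.

Lemma down_closed_link v P : down_closed P -> down_closed (link v P).
Proof.
move=> dP S S' sub; rewrite !inE => /andP[vS SP].
rewrite (contraNN (subsetP sub v)) //=.
by apply: dP SP; apply: setUS.
Qed.

Lemma card_level_link j v P :
  #|level j (link v P)| = #|[set S : {set T} in level j.+1 P | v \in S]|.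
Proof.
have inj : {in level j (link v P) &, injective (setU [set v])}.
  move=> S S'; rewrite !inE => /andP[/andP[vS _] _] /andP[/andP[vS' _] _] eqS.
  by rewrite -(setU1K vS) -(setU1K vS') /= eqS.
rewrite -(card_in_imset inj); apply: eq_card => S; rewrite !inE.
apply/imsetP/andP => [[S' + ->]|[/andP[SP /eqP cS] vS]].
  rewrite !inE => /andP[/andP[vS' SP] /eqP <-].
  by rewrite SP cardsU1 vS' add1n !eqxx.
exists (S :\ v); last by rewrite setD1K.
by rewrite !inE eqxx setD1K // SP /= -eqSS -cS [X in _ == X](cardsD1 v S) vS.
Qed.

(** Both sides count the pairs of an element and a [j.+1]-set of [P] containing it. *)
Lemma sum_card_level_link j P :
  (\sum_v #|level j (link v P)| = j.+1 * #|level j.+1 P|)%N.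
Proof.
under eq_bigr => v _ do rewrite card_level_link -sum1dep_card.
rewrite (exchange_big_dep (mem (level j.+1 P))) /=; last by move=> v S _ /andP[].
rewrite mulnC -sum_nat_const; apply: eq_bigr => S SP.
rewrite sum1dep_card -[RHS](_ : #|S| = j.+1); last first.
  by move: SP; rewrite inE => /andP[_ /eqP].
by apply: eq_card => v; rewrite inE SP.
Qed.

Lemma card_level_le j P (A : {set T}) :
  (forall S, S \in P -> S \subset A) -> (#|level j P| <= #|A| ^ j)%N.
Proof.
move=> PA; apply: (@leq_trans 'C(#|A|, j)); last first.
  have [jA|/bin_small -> //] := leqP j #|A|.
  apply: leq_trans (_ : #|A| ^_ j <= _)%N; last first.
    by rewrite ffact_prod -[X in (_ <= X ^ j)%N]subn0 -[X in (_ <= _ ^ X)%N]card_ord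
      -prod_nat_const; apply: leq_prod => i _; rewrite leq_sub2l.
  by rewrite -bin_ffact leq_pmulr // fact_gt0.
rewrite -cards_draws; apply/subset_leq_card/subsetP => S.
by rewrite !inE => /andP[/PA -> ->].
Qed.

End SetFamilies.

(** * Shattered sets and the deletion of rows *)

Section Shattering.
Variables (T I : finType) (c : I -> {set T}).
Implicit Types (A B S : {set T}) (X Y : {set I}) (v : T).

Definition shatters X S := powerset S \subset [set c x :&: S | x in X].
Definition shattered A X := [set S : {set T} | (S \subset A) && shatters X S].
Definition separates A X := {in X &, injective (fun x => c x :&: A)}.

Lemma shattersP X S :
  reflect (forall B : {set T}, B \subset S -> exists2 x, x \in X & c x :&: S = B)
          (shatters X S).
Proof.
apply: (iffP subsetP) => [sh B BS|sh B].
  have: B \in [set c x :&: S | x in X] by apply: sh; rewrite inE.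
  by case/imsetP => x xX ->; exists x.
by rewrite inE => /sh[x xX <-]; apply: imset_f.
Qed.

Lemma shattersS X S Y S' :
  X \subset Y -> S' \subset S -> shatters X S -> shatters Y S'.
Proof.
move=> XY SS /shattersP sh; apply/shattersP => B BS.
have [x xX xS] := sh B (subset_trans BS SS).
exists x; first exact: (subsetP XY).
by rewrite -(setIidPr SS) setIA xS; apply/setIidPl.
Qed.

Lemma down_closed_shattered A X : down_closed (shattered A X).
Proof.
move=> S S' sub; rewrite !inE => /andP[SA sh].
by rewrite (subset_trans sub SA) (shattersS (subxx _) sub sh).
Qed.

Lemma shatteredS A X A' X' :
  A' \subset A -> X' \subset X -> shattered A' X' \subset shattered A X.
Proof.
move=> AA XX; apply/subsetP => S; rewrite !inE => /andP[SA sh].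
by rewrite (subset_trans SA AA) (shattersS XX (subxx _) sh).
Qed.

Lemma separatesS A X A' X' :
  A' \subset A -> X' \subset X -> separates A' X -> separates A X'.
Proof.
move=> AA XX sep x y xX yX /= eqA.
apply: (sep x y (subsetP XX x xX) (subsetP XX y yX)).
by rewrite /= -(setIidPr AA) !setIA eqA.
Qed.

Lemma separates_card A X : separates A X -> (#|X| <= 2 ^ #|A|)%N.
Proof.
move=> sep; rewrite -card_powerset -(card_in_imset sep).
apply/subset_leq_card/subsetP => _ /imsetP[x _ ->].
by rewrite inE subsetIr.
Qed.

(* The part of [X] that is lost when row [v] is deleted is not only separated
   by the other rows: whatever it shatters is shattered by [X] jointly with
   [v]. *)
Lemma delete_row A X v : v \in A -> separates A X ->
  exists Y : {set I}, [/\ Y \subset X, separates (A :\ v) Y,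
    separates (A :\ v) (X :\: Y) &
    shattered (A :\ v) Y \subset link v (shattered A X)].
Proof.
move=> vA sep.
(* Among columns of [X] that agree off [v], at most two can occur; [Y] takes from each such pair the
   column avoiding [v]. *)
pose Y := [set x in X | (v \notin c x) &&
  [exists y in X, (v \in c y) && (c y :&: (A :\ v) == c x :&: (A :\ v))]].
have eqA x y : (v \in c x) = (v \in c y) ->
    c x :&: (A :\ v) = c y :&: (A :\ v) -> c x :&: A = c y :&: A.
  move=> exy /setP e; apply/setP => u; have := e u; rewrite !inE.
  by have [->|//] := eqVneq u v; rewrite exy.
have YX : Y \subset X by apply/subsetP => x; rewrite inE => /andP[].
exists Y; split=> //.
- move=> x y; rewrite !inE => /and3P[xX vx _] /and3P[yX vy _] /= exy.
  by apply: sep => //=; apply: eqA => //; rewrite (negPf vx) (negPf vy).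
- move=> x y; rewrite !inE => /andP[xnY xX] /andP[ynY yX] /= exy.
  apply: sep => //=; apply: eqA => //.
  move: xnY ynY; rewrite xX yX /=.
  case vx: (v \in c x); case vy: (v \in c y) => //=.
    by move=> _ /existsP[]; exists x; rewrite xX vx exy eqxx.
  by move=> /existsP[]; exists y; rewrite yX vy exy eqxx.
- apply/subsetP => S; rewrite !inE => /andP[SAv /shattersP sh].
  have vS : v \notin S by apply: contraL isT => /(subsetP SAv); rewrite !inE eqxx.
  have SA : v |: S \subset A.
    by rewrite subUset sub1set vA (subset_trans SAv (subsetDl _ _)).
  rewrite vS SA; apply/shattersP => B BS.
  have [|x xY xS] := sh (B :\ v); first by rewrite subDset.
  have /and3P[xX vx /existsP[y /and3P[yX vy /eqP exy]]] : [&& x \in X, v \notin c x &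
      [exists y in X, (v \in c y) && (c y :&: (A :\ v) == c x :&: (A :\ v))]].
    by move: xY; rewrite inE.
  have yS : c y :&: S = B :\ v.
    by rewrite -xS -(setIidPr SAv) !setIA exy.
  (* A trace containing [v] is realized by the partner [y], any other one by [x] itself. *)
  have [vB|vB] := boolP (v \in B); [exists y|exists x] => //; rewrite setIUr.
    by rewrite yS (setIidPr _) ?sub1set // setD1K.
  rewrite xS (disjoint_setI0 _) ?set0U; last by rewrite disjoints_subset subsetC sub1set inE.
  by apply/setDidPl; rewrite disjoint_sym disjoints1.
Qed.

(** The rows of [L] are deleted one at a time by [delete_row]. Each deletion costs at most [B]
    columns, and the surviving columns are separated by [A :\: L], hence number at most [B']. Links
    may be taken in the original family throughout, since shattered families only shrink along the
    way. *)
Lemma delete_rows (R : realType) (L A : {set T}) X (B B' : R) :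
  L \subset A -> separates A X ->
  (forall v A' Y, v \in L -> A' \subset A -> separates A' Y ->
     shattered A' Y \subset link v (shattered A X) -> #|Y|%:R <= B) ->
  (forall Y, Y \subset X -> separates (A :\: L) Y -> #|Y|%:R <= B') ->
  #|X|%:R <= #|L|%:R * B + B'.
Proof.
have [n] := ubnP #|L|; elim: n L A X => // n IHn L A X.
have [->|[v vL]] := set_0Vmem L.
  by move=> _ _ sep _ hB'; rewrite cards0 mul0r add0r; apply: hB'; rewrite ?setD0.
rewrite (cardsD1 v) vL ltnS /= => ltn LA sep hB hB'.
have vA := subsetP LA v vL.
have [Y [YX sepY sepZ shY]] := delete_row vA sep.
have hY : #|Y|%:R <= B by apply: (hB v (A :\ v) Y) => //; exact: subsetDl.
suff hZ : #|X :\: Y|%:R <= #|L :\ v|%:R * B + B'.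
  by rewrite -(cardsID Y X) (setIidPr YX) !natrD; lra.
apply: (IHn (L :\ v) (A :\ v)) => //.
- exact: setSD.
- move=> u A' Z uL A'A sepZ' shZ; apply: (hB u A' Z) => //.
  + by move: uL; rewrite !inE => /andP[].
  + exact: subset_trans A'A (subsetDl _ _).
  + apply: subset_trans shZ _; apply/subsetP => S; rewrite !inE.
    move=> /and3P[-> SA sh].
    rewrite (subset_trans SA (subsetDl _ _)).
    exact: shattersS (subsetDl _ _) (subxx _) sh.
- move=> Z ZX sepZ'; apply: hB'; first exact: subset_trans ZX (subsetDl _ _).
  apply: separatesS sepZ' => //; apply/subsetP => u; rewrite !inE.
  case/andP => + /andP[uv uA]; by rewrite uv uA andbT.
Qed.

End Shattering.

(** * Real powers and a Kruskal-Katona type inequality *)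

Lemma powRD_gt0 (R : realType) (a r s : R) :
  0 < a -> a `^ (r + s) = a `^ r * a `^ s.
Proof. by move=> a0; rewrite powRD // (gt_eqF a0) implybT. Qed.

Lemma ler_powR_base (R : realType) (a b r : R) :
  0 <= r -> 0 <= a -> a <= b -> a `^ r <= b `^ r.
Proof.
by move=> r0 a0 ab; apply: ge0_ler_powR; rewrite ?nnegrE // (le_trans a0).
Qed.

Lemma powR_interpolate (R : realType) (e x y r : R) :
  0 < e -> 0 <= r <= 1 -> e <= x -> e <= y -> e <= x `^ r * y `^ (1 - r).
Proof.
move=> e0 /andP[r0 r1] ex ey.
have -> : e = e `^ r * e `^ (1 - r).
  by rewrite -powRD_gt0 // addrC subrK powRr1 // ltW.
by apply: ler_pM; rewrite ?powR_ge0 //; apply: ler_powR_base; rewrite ?subr_ge0 // ltW.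
Qed.

(* Each link is bounded twice by induction, through its own [j]-sets and through
   the [j.+1]-sets of [P]; the interpolation of the two that is linear in the
   former can be summed over the links. *)
Lemma level_powR (R : realType) (T : finType) (k j : nat) (P : {set {set T}}) :
  down_closed P -> (j <= k)%N ->
  #|level k.+1 P|%:R <= #|level j.+1 P|%:R `^ (k.+1%:R / j.+1%:R) :> R.
Proof.
elim: k j P => [|k IHk] j P dP.
  rewrite leqn0 => /eqP ->; rewrite divff; last by rewrite pnatr_eq0.
  by rewrite powRr1.
rewrite leq_eqVlt => /predU1P[->|]; first by rewrite divff ?powRr1 // pnatr_eq0.
rewrite ltnS => jk.
pose D : R := #|level j.+1 P|%:R; rewrite -/D.
have D0 : 0 <= D by [].
have link_le v : #|level k.+1 (link v P)|%:R <=
    #|level j (link v P)|%:R * D `^ ((k.+1%:R - j%:R) / j.+1%:R).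
  have [->|/card_gt0P[S SL]] := posnP #|level k.+1 (link v P)|.
    by rewrite mulr_ge0 // powR_ge0.
  have e0 : 0 < #|level k.+1 (link v P)|%:R :> R.
    by rewrite ltr0n; apply/card_gt0P; exists S.
  have leD : #|level k.+1 (link v P)|%:R <= D `^ (k.+1%:R / j.+1%:R).
    apply: le_trans (IHk j P dP jk); rewrite ler_nat.
    exact/subset_leq_card/levelS/link_sub.
  (* For [j = 0] the factor coming from the link is at least 1, as a nonempty down-closed family
     contains the empty set. *)
  case: j jk @D D0 leD => [|j] jk D D0 leD.
    rewrite subr0 (le_trans leD) // ler_peMl ?powR_ge0 // ler1n.
    apply/card_gt0P; exists set0; rewrite inE cards0 eqxx andbT.
    move: SL; rewrite inE => /andP[SL _].
    by apply: down_closed_link SL => //; apply: sub0set.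
  have leL := IHk j _ (down_closed_link (v := v) dP) (ltnW jk).
  (* This weight cancels the exponent in [leL], which makes the interpolation linear in the level of
     the link. *)
  have r01 : 0 <= (j.+1%:R / k.+1%:R : R) <= 1.
    apply/andP; split; first by rewrite divr_ge0.
    by rewrite ler_pdivrMr ?ltr0Sn // mul1r ler_nat ltnW.
  have := powR_interpolate e0 r01 leL leD.
  rewrite -!powRrM.
  have -> : k.+1%:R / j.+1%:R * (j.+1%:R / k.+1%:R) = 1 :> R.
    by rewrite mulrA divfK ?divff ?pnatr_eq0.
  rewrite powRr1 //.
  suff -> : k.+1%:R / j.+2%:R * (1 - j.+1%:R / k.+1%:R) =
            (k.+1%:R - j.+1%:R) / j.+2%:R :> R by [].
  have : k.+1%:R != 0 :> R by rewrite pnatr_eq0.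
  have : j.+2%:R != 0 :> R by rewrite pnatr_eq0.
  by move: (k.+1%:R : R) (j.+2%:R : R) (j.+1%:R : R) => x y z y0 x0; field; rewrite x0 y0.
have : (\sum_v #|level k.+1 (link v P)|)%:R <=
    j.+1%:R * D * D `^ ((k.+1%:R - j%:R) / j.+1%:R).
  rewrite -natrM -sum_card_level_link !natr_sum mulr_suml.
  exact: ler_sum.
rewrite sum_card_level_link natrM -mulrA.
have [D00|Dn0] := eqVneq D 0.
  rewrite D00 mul0r mulr0 pmulr_rle0 ?ltr0Sn // => le0.
  by rewrite (le_trans le0) // powR_ge0.
have Dp : 0 < D by rewrite lt_def Dn0.
rewrite -{1}(powRr1 D0) -powRD_gt0 //.
have -> : 1 + (k.+1%:R - j%:R) / j.+1%:R = k.+2%:R / j.+1%:R :> R.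
  have jn0 : j.+1%:R != 0 :> R by rewrite pnatr_eq0.
  have -> : k.+2%:R = k.+1%:R - j%:R + j.+1%:R :> R by rewrite -!natr1; ring.
  by rewrite [RHS]mulrDl divff // addrC.
move=> le; rewrite -(ler_pM2l (ltr0Sn R k.+1)); apply: le_trans le _.
by rewrite ler_wpM2r ?powR_ge0 // ler_nat ltnS leqW.
Qed.

(** * From shattering blocks of columns to containment *)

Lemma enum_val_lt n (A : {set 'I_n}) (i j : 'I_#|A|) :
  (i < j)%N -> (enum_val i < enum_val j)%N.
Proof.
move=> ij; have x0 := enum_val i.
rewrite !(enum_val_nth x0).
apply: (@sorted_ltn_nth _ (relpre val ltn)) => //.
- by move=> x y z /=; apply: ltn_trans.
- rewrite [enum A]/(enum_mem _) -enumT; apply: sorted_filter.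
    by move=> x y z /=; apply: ltn_trans.
  by rewrite -sorted_map val_enum_ord iota_ltn_sorted.
- by rewrite inE -cardE.
- by rewrite inE -cardE.
Qed.

Definition colset m n (M : 'M[bool]_(m, n)) (x : 'I_n) : {set 'I_m} :=
  [set r | M r x].

(** The rows of the copy are those of [S]. The [s]-th block that shatters [S] has a column whose
    trace on [S] is column [s] of [F], and the order of the blocks puts these columns in the right
    order. *)
Lemma contains_blocks m n k l N (M : 'M[bool]_(m, n)) (F : 'M[bool]_(k, l))
    (blk : 'I_N -> {set 'I_n}) (S : {set 'I_m}) :
  (forall (i j : 'I_N) (x y : 'I_n), (i < j)%N -> x \in blk i -> y \in blk j -> (x < y)%N) ->
  #|S| = k -> (l <= #|[set i | shatters (colset M) (blk i) S]|)%N ->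
  contains M F.
Proof.
move=> blk_lt cS; set J := [set i | _] => lJ.
pose f : {ffun 'I_k -> 'I_m} := [ffun r => enum_val (cast_ord (esym cS) r)].
pose idx (s : 'I_l) : 'I_N := enum_val (widen_ord lJ s).
have fS r : f r \in S by rewrite ffunE enum_valP.
have inj_f : injective f.
  by move=> r r'; rewrite !ffunE => /enum_val_inj/cast_ord_inj.
have /fin_all_exists[g gP] (s : 'I_l) :
    exists x, (x \in blk (idx s)) &&
              (colset M x :&: S == [set f r | r in [pred r | F r s]]).
  have : idx s \in J := enum_valP _.
  rewrite inE => /shattersP sh.
  have [|x xb xS] := sh [set f r | r in [pred r | F r s]].
    by apply/subsetP => _ /imsetP[r _ ->].
  by exists x; rewrite xb xS eqxx.
apply/existsP; exists f; apply/existsP; exists [ffun s => g s].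
apply/and3P; split.
- apply/forallP => r; apply/forallP => r'; apply/implyP => rr'.
  by rewrite !ffunE; apply: enum_val_lt.
- apply/forallP => s; apply/forallP => s'; apply/implyP => ss'.
  rewrite !ffunE; have /andP[gs _] := gP s; have /andP[gs' _] := gP s'.
  by apply: blk_lt gs gs'; apply: enum_val_lt.
- apply/eqP/matrixP => r s; rewrite !mxE [_ s]ffunE.
  have /andP[_ /eqP/setP/(_ (f r))] := gP s.
  by rewrite mem_imset // !inE fS andbT => ->.
Qed.

(* Cut [X] into consecutive blocks just large enough to shatter [t] of the
   [k]-sets each; a [k]-set shattered by [l] of the blocks gives a copy of
   [F]. *)
Lemma card_le_blocks (R : realType) m n k l (M : 'M[bool]_(m, n))
    (F : 'M[bool]_(k, l)) (A : {set 'I_m}) (X : {set 'I_n}) (B t : R) :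
  ~~ contains M F -> 0 <= B -> 0 < t ->
  (forall Y : {set 'I_n}, Y \subset X -> B < #|Y|%:R ->
     t <= #|level k (shattered (colset M) A Y)|%:R) ->
  #|X|%:R <= (B + 1) * (l%:R * #|level k (shattered (colset M) A X)|%:R / t + 1).
Proof.
move=> FM B0 t0 big.
set K := level k _.
(* The least integer above [B]: a block of [p] columns qualifies for the hypothesis, while [p] is at
   most [B + 1]. *)
pose p := (Num.truncn B).+1.
have Bp : B < p%:R by apply: truncnS_gt.
have pB : p%:R <= B + 1 by rewrite -natr1 lerD2r truncn_le.
pose N := (#|X| %/ p)%N; pose s := enum X.
pose blk (i : 'I_N) := [set x in take p (drop (i * p) s)].
have szs : size s = #|X| by rewrite -cardE.
have iN (i : 'I_N) : ((i * p) + p <= #|X|)%N.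
  rewrite -mulSnr; apply: leq_trans (leq_trunc_div #|X| p).
  by rewrite leq_mul2r ltn_ord orbT.
have blkX i : blk i \subset X.
  by apply/subsetP => x; rewrite inE => /mem_take/mem_drop; rewrite mem_enum.
have card_blk i : #|blk i| = p.
  rewrite cardsE (card_uniqP _) ?take_uniq ?drop_uniq ?enum_uniq //.
  by rewrite size_takel // size_drop szs leq_subRL ?iN // (leq_trans (leq_addr _ _) (iN i)).
have blkP (x0 : 'I_n) i x : x \in blk i ->
    exists2 q, (i * p <= q < i * p + p)%N & x = nth x0 s q.
  rewrite inE => /(nthP x0)[q]; rewrite size_take_min leq_min => /andP[qp _] <-.
  by exists (i * p + q)%N; rewrite ?nth_take ?nth_drop // leq_addr ltn_add2l.
have blk_lt (i j : 'I_N) (x y : 'I_n) : (i < j)%N -> x \in blk i -> y \in blk j -> (x < y)%N.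
  move=> ij xi yj; have [q /andP[_ q1] ->] := blkP x i x xi.
  have [q' /andP[q2 q3] ->] := blkP x j y yj.
  have jX := iN j.
  have qq' : (q < q')%N.
    apply: leq_trans q1 (leq_trans _ q2).
    by rewrite -mulSnr leq_mul2r ij orbT.
  have q'X : (q' < #|X|)%N by apply: leq_trans jX.
  have qX : (q < #|X|)%N by apply: ltn_trans q'X.
  pose iq := Ordinal qX; pose iq' := Ordinal q'X.
  rewrite -[q]/(val iq) -[q']/(val iq') -!enum_val_nth.
  exact: enum_val_lt.
(* Pairs of a block and a [k]-set that it shatters are counted twice: each block is in at least [t]
   pairs, each set in at most [l]. *)
have lower : N%:R * t <= (\sum_(i < N) #|level k (shattered (colset M) A (blk i))|)%:R.
  rewrite natr_sum -[X in X%:R * t]card_ord mulr_natl -sumr_const.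
  by apply: ler_sum => i _; apply: big; rewrite ?card_blk.
have upper : (\sum_(i < N) #|level k (shattered (colset M) A (blk i))| <= #|K| * l)%N.
  have -> : (\sum_(i < N) #|level k (shattered (colset M) A (blk i))| =
     \sum_(i < N) \sum_(S in K | shatters (colset M) (blk i) S) 1)%N.
    apply: eq_bigr => i _; rewrite sum1dep_card; apply: eq_card => S; rewrite !inE.
    case: (boolP (shatters _ (blk i) _)) => [sh|]; rewrite ?andbF //.
    by rewrite (shattersS (blkX i) (subxx _) sh) !andbT.
  rewrite (exchange_big_dep (mem K)) /=; last by move=> i S _ /andP[].
  rewrite -sum_nat_const; apply: leq_sum => S SK.
  rewrite sum1dep_card leqNgt; apply: contra FM => lS.
  have cS : #|S| = k by move: SK; rewrite !inE => /andP[_ /eqP].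
  apply: (contains_blocks F blk_lt cS).
  apply: leq_trans (ltnW lS) _; apply/subset_leq_card/subsetP => i.
  by rewrite !inE => /andP[].
have Nle : N%:R <= l%:R * #|K|%:R / t.
  by rewrite ler_pdivlMr // (le_trans lower) // -natrM ler_nat mulnC.
(* The extra 1 covers the fewer than [p] columns left over after the last full block. *)
apply: (@le_trans _ _ (p%:R * (N%:R + 1))).
  rewrite natr1 -natrM ler_nat mulnC ltnW //.
  by rewrite mulSn [X in (X < _)%N](divn_eq #|X| p) addnC ltn_add2r ltn_mod.
apply: ler_pM => //; first by rewrite addr_ge0.
by rewrite lerD2r.
Qed.

(** * Degree thresholds and the two kinds of bounds that improve each other *)

Section Thresholds.
Variable R : realType.
Implicit Types (a b d C : R).

(** This is [b] times the binomial coefficient j choose 2; consecutive values differ by [b * j], the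
    exponent in the number of high-degree rows. *)
Definition threshold b (j : nat) : R := b * (j%:R * (j%:R - 1)) / 2.

Lemma threshold0 b : threshold b 0 = 0.
Proof. by rewrite /threshold !mul0r mulr0 mul0r. Qed.

Lemma thresholdS b j : threshold b j.+1 = threshold b j + b * j%:R.
Proof. by rewrite /threshold -natr1; field. Qed.

Variables (T I : finType) (c : I -> {set T}).

(** The scale [a] comes from the ambient matrix, whereas [A] stands for the rows of high degree that
    remain after deletion. One [C] serves all [j] up to [k] because the deletion recurses on [j]. *)
Definition thin_bound k b C := forall j a (A : {set T}) (X : {set I}),
  (j <= k)%N -> 1 <= a -> separates c A X ->
  #|A|%:R <= j.+1%:R * a `^ (b * j%:R) ->
  #|level j.+1 (shattered c A X)|%:R <= a `^ threshold b j.+1 ->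
  #|X|%:R <= C * a `^ j%:R.

(* Deleting a row of low degree in the hypergraph of shattered [j]-sets costs
   at most the bound for [j-1]; the rows of high degree are few enough for
   [thin_bound]. *)
Lemma card_le_below_threshold k b C : 0 <= C -> thin_bound k b C ->
  forall j a (A : {set T}) (X : {set I}), (j <= k.+1)%N -> 1 <= a ->
    #|A|%:R <= a -> separates c A X ->
    #|level j (shattered c A X)|%:R < a `^ threshold b j ->
    #|X|%:R <= j%:R * C * a `^ (j%:R - 1).
Proof.
move=> C0 thin; elim=> [|j IHj] a A X jk a1 Aa sep.
  (* Here the threshold is 1, so not even the empty set is shattered and [X] is empty. *)
  rewrite threshold0 powRr0 ltrn1 ltnS leqn0 cards_eq0 => /eqP lev0.
  have [->|[x xX]] := set_0Vmem X; first by rewrite cards0 !mul0r.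
  suff : set0 \in level 0 (shattered c A X) by rewrite lev0 inE.
  rewrite !inE sub0set cards0 eqxx andbT; apply/shattersP => B.
  by rewrite subset0 => /eqP ->; exists x => //; rewrite setI0.
move=> lt_lev.
have a0 : 0 < a by apply: lt_le_trans a1.
pose deg v := #|level j (link v (shattered c A X))|.
pose L := [set v in A | (deg v)%:R < a `^ threshold b j].
have jS : j.+1%:R - 1 = j%:R :> R by rewrite -natr1 addrK.
have LA : L \subset A by apply/subsetP => v; rewrite inE => /andP[].
(* At most [a] deletions at the price of the bound for [j], plus the bound for the remaining
   rows. *)
have -> : j.+1%:R * C * a `^ (j.+1%:R - 1) =
          a * (j%:R * C * a `^ (j%:R - 1)) + C * a `^ j%:R.
  have aj : a `^ j%:R = a * a `^ (j%:R - 1).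
    by rewrite -{2}(powRr1 (ltW a0)) -powRD_gt0 // addrC subrK.
  by rewrite jS -natr1 aj; ring.
apply: le_trans (_ : _ <= #|L|%:R * (j%:R * C * a `^ (j%:R - 1)) + C * a `^ j%:R) _;
  last first.
  rewrite lerD2r ler_wpM2r ?mulr_ge0 ?powR_ge0 //.
  by apply: le_trans Aa; rewrite ler_nat subset_leq_card.
apply: (delete_rows LA sep) => [v A' Y vL A'A sepY shY|Y YX sepY].
  apply: (IHj a A' Y) => //; first exact: ltnW.
    by apply: le_trans Aa; rewrite ler_nat subset_leq_card.
  move: vL; rewrite inE => /andP[_]; apply: le_lt_trans.
  by rewrite ler_nat; apply/subset_leq_card/levelS.
apply: (thin j a (A :\: L) Y) => //; last first.
  apply: le_trans (ltW lt_lev); rewrite ler_nat.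
  by apply/subset_leq_card/levelS/shatteredS => //; apply: subsetDl.
(* Each remaining row has degree at least [a] to the power [threshold b j], and all degrees add up
   to [j.+1] times the number of shattered [j.+1]-sets; this bounds the number of such rows. *)
rewrite -(ler_pM2r (powR_gt0 (threshold b j) a0)) -mulrA -powRD_gt0 // [b * _ + _]addrC.
rewrite -thresholdS.
apply: le_trans (_ : _ <= j.+1%:R * #|level j.+1 (shattered c A X)|%:R) _; last first.
  by rewrite ler_wpM2l // ltW.
rewrite -natrM -sum_card_level_link natr_sum mulr_natl -sumr_const.
apply: le_trans (_ : _ <= \sum_(v in A :\: L) (deg v)%:R) _.
  apply: ler_sum => v; rewrite !inE => /andP[+ vA].
  by rewrite vA -leNgt.
rewrite [leRHS](bigID (mem (A :\: L))) /= lerDl.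
by apply: sumr_ge0.
Qed.

(** The second summand is a block size [a^k] times a number of blocks, the latter being the number
    of shattered sets over [a^d]; the first summand allows for an incomplete block. *)
Definition shatter_bound k C d := forall a (A : {set T}) (X : {set I}),
  1 <= a -> #|A|%:R <= a -> separates c A X ->
  #|X|%:R <= C * (a `^ k%:R +
                  #|level k.+1 (shattered c A X)|%:R * a `^ (k%:R - d)).

(** The bound is applied at the smaller scale [h], the maximal number of rows in [thin_bound]. The
    two upper bounds on [b] bring the two summands down to order [a^j]. *)
Lemma shatter_bound_thin k b C d :
  0 <= C -> 0 <= b -> 0 <= d <= k%:R -> b * k%:R <= 1 ->
  b * (k.+1%:R / 2 + (k%:R - d)) <= 1 ->
  shatter_bound k C d -> thin_bound k b (C * (2 * k.+1%:R `^ k%:R)).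
Proof.
move=> C0 b0 /andP[d0 dk] bk bd bound j a A X jk a1 sep leA lev.
have a0 : 0 < a by apply: lt_le_trans a1.
pose h := j.+1%:R * a `^ (b * j%:R).
have h1 : 1 <= h.
  rewrite -[1]mulr1 ler_pM ?ler1n //.
  by rewrite -[X in X <= _](powRr0 a) ler_powR // mulr_ge0.
have hpow r : 0 <= r <= k%:R -> h `^ r <= k.+1%:R `^ k%:R * a `^ (b * j%:R * r).
  move=> /andP[r0 rk].
  rewrite powRM ?powR_ge0 // -powRrM ler_wpM2r ?powR_ge0 //.
  apply: le_trans (_ : _ <= k.+1%:R `^ r) _; last by rewrite ler_powR // ler1n.
  by apply: ler_powR_base => //; rewrite ler_nat.
(* [level_powR] multiplies the exponent [threshold b j.+1] by [(k+1)/(j+1)], which cancels its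
   factor [j+1]. *)
have levk : #|level k.+1 (shattered c A X)|%:R <= a `^ (b * j%:R * (k.+1%:R / 2)).
  apply: le_trans (level_powR R (@down_closed_shattered _ _ c A X) jk) _.
  apply: le_trans (ler_powR_base _ _ lev) _; rewrite ?divr_ge0 // -powRrM.
  rewrite [X in a `^ X](_ : _ = b * j%:R * (k.+1%:R / 2)) //.
  rewrite /threshold; have -> : j.+1%:R - 1 = j%:R :> R by rewrite -natr1 addrK.
  have : j.+1%:R != 0 :> R by rewrite pnatr_eq0.
  by move: (j.+1%:R : R) => x x0; field.
apply: le_trans (bound h A X h1 leA sep) _.
rewrite -mulrA ler_wpM2l //.
rewrite [leRHS](_ : _ = k.+1%:R `^ k%:R * a `^ j%:R + k.+1%:R `^ k%:R * a `^ j%:R);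
  last by ring.
apply: lerD.
  apply: le_trans (hpow _ _) _; first by rewrite lexx ler0n.
  by rewrite ler_wpM2l ?powR_ge0 // ler_powR // mulrAC ler_piMl.
apply: le_trans (ler_pM _ _ levk (hpow _ _)) _; rewrite ?powR_ge0 //.
  by rewrite subr_ge0 dk gerBl.
rewrite mulrCA ler_wpM2l ?powR_ge0 // -powRD_gt0 // ler_powR //.
by rewrite -mulrDr mulrAC ler_piMl.
Qed.

(** The start of the iteration: for [b = 0] at most [j.+1] rows remain, and these separate boundedly
    many columns. *)
Lemma thin_bound0 k : thin_bound k 0 (2 ^+ k.+1).
Proof.
move=> j a A X jk a1 sep; rewrite mul0r powRr0 mulr1 ler_nat => Aj _.
apply: le_trans (_ : _ <= (2 ^ #|A|)%:R) _; first by rewrite ler_nat (separates_card sep).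
rewrite natrX; apply: le_trans (_ : _ <= 2 ^+ k.+1) _.
  by rewrite ler_eXn2l ?ltr1n // (leq_trans Aj).
by rewrite ler_peMr ?exprn_ge0 // -[leLHS](powRr0 a) ler_powR.
Qed.

End Thresholds.

(** * The iteration improving the exponent *)

Lemma thin_bound_shatter (R : realType) m n k l (M : 'M[bool]_(m, n))
    (F : 'M[bool]_(k.+1, l)) (b C : R) :
  ~~ contains M F -> 0 <= C -> thin_bound (colset M) k b C ->
  shatter_bound (colset M) k ((k.+1%:R * C + 1) * (l%:R + 1)) (threshold b k.+1).
Proof.
move=> FM C0 thin a A X a1 Aa sep.
have a0 : 0 < a by apply: lt_le_trans a1.
have ak1 : 1 <= a `^ k%:R by rewrite -[leLHS](powRr0 a) ler_powR.
pose B := k.+1%:R * C * a `^ k%:R.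
have B0 : 0 <= B by rewrite !mulr_ge0 ?powR_ge0.
pose t := a `^ threshold b k.+1.
have t0 : 0 < t by apply: powR_gt0.
have := card_le_blocks (A := A) (X := X) FM B0 t0.
set D : R := #|level _ _|%:R => blocks.
apply: le_trans (blocks _) _ => [Y YX|].
  (* A block shattering fewer than [t] sets falls under [card_le_below_threshold] with [j = k.+1],
     whose bound is exactly [B]. *)
  rewrite leNgt; apply: contraL => small; rewrite -leNgt /B.
  have -> : k%:R = k.+1%:R - 1 :> R by rewrite -natr1 addrK.
  apply: (card_le_below_threshold C0 thin) small => //.
  exact: separatesS sep.
have -> : a `^ (k%:R - threshold b k.+1) = a `^ k%:R / t.
  by rewrite powRD_gt0 // powRN.
have D0 : 0 <= D by [].
rewrite [leRHS](_ : _ = ((k.+1%:R * C + 1) * a `^ k%:R) * ((l%:R + 1) * (D / t + 1)));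
  last by ring.
have tV0 : 0 <= t^-1 by rewrite invr_ge0 ltW.
apply: ler_pM; rewrite ?addr_ge0 ?mulr_ge0 ?powR_ge0 //.
  by rewrite mulrDl mul1r lerD2l.
rewrite mulrDl mul1r mulrDr mulr1 -mulrA -addrA lerD2l.
have Dt0 : 0 <= D / t by rewrite divr_ge0 // ltW.
have l0 : 0 <= l%:R :> R by [].
lra.
Qed.

(** These values rise from 0 to [1/k], the largest [b] with [b * k <= 1], slowly enough for each to
    be admissible in [shatter_bound_thin] given the gain [d] of its predecessor. *)
Definition slope (R : realType) (k n : nat) : R := n%:R / (n.+1%:R * k%:R).

Lemma threshold_slope (R : realType) k n : (0 < k)%N ->
  threshold (slope R k n) k.+1 = k.+1%:R / 2 - k.+1%:R / (2 * n.+1%:R).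
Proof.
move=> k0; rewrite /threshold /slope -!natr1.
have k0' : k%:R != 0 :> R by rewrite pnatr_eq0 -lt0n.
have n0' : n%:R + 1 != 0 :> R by rewrite natr1 pnatr_eq0.
by field; rewrite k0' n0'.
Qed.

Lemma shatter_bound_slope (R : realType) k l (F : 'M[bool]_(k.+1, l)) n :
  (0 < k)%N -> exists2 C : R, 0 <= C &
  forall m N (M : 'M[bool]_(m, N)), ~~ contains M F ->
    shatter_bound (colset M) k C (threshold (slope R k n) k.+1).
Proof.
move=> k0; elim: n => [|n [C C0 bound]].
  exists ((k.+1%:R * 2 ^+ k.+1 + 1) * (l%:R + 1)).
    by rewrite mulr_ge0 ?addr_ge0 ?mulr_ge0 ?exprn_ge0.
  move=> m N M FM; apply: (thin_bound_shatter FM); first exact: exprn_ge0.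
  by rewrite /slope mul0r; apply: thin_bound0.
have C'0 : 0 <= C * (2 * k.+1%:R `^ k%:R) by rewrite !mulr_ge0 ?powR_ge0.
exists ((k.+1%:R * (C * (2 * k.+1%:R `^ k%:R)) + 1) * (l%:R + 1)).
  by rewrite mulr_ge0 ?addr_ge0 // mulr_ge0.
move=> m N M FM; apply: (thin_bound_shatter FM) => //.
have k1 : 1 <= k%:R :> R by rewrite ler1n.
have n1 : 1 <= n.+1%:R :> R by rewrite ler1n.
have n2 : n.+2%:R = n.+1%:R + 1 :> R by rewrite -natr1.
have kS : k.+1%:R = k%:R + 1 :> R by rewrite -natr1.
apply: shatter_bound_thin (bound m N M FM) => //.
- by rewrite /slope divr_ge0 // mulr_ge0.
- rewrite threshold_slope //; apply/andP; split.
    rewrite subr_ge0 ler_wpM2l // lef_pV2 ?posrE; lra.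
  have : 0 <= k.+1%:R / (2 * n.+1%:R) :> R by rewrite divr_ge0 // mulr_ge0.
  by move: (k.+1%:R / _) => z z0; lra.
- rewrite /slope invfM mulrA divfK; last by rewrite pnatr_eq0 -lt0n.
  by rewrite ler_pdivrMr; lra.
- rewrite threshold_slope // /slope n2 kS.
  move: (k%:R : R) (n.+1%:R : R) k1 n1 => x y x1 y1.
  rewrite mulrAC ler_pdivrMr; last by rewrite mulr_gt0; lra.
  (* What remains is [(k+1)/2 <= k]. *)
  rewrite mul1r [leLHS](_ : _ = y * x + (x + 1) / 2); last by field; lra.
  by lra.
Qed.

(** * The bound on [fs] and the theorem *)

Lemma fs_le_powR (R : realType) (k l : nat) (F : 'M[bool]_(k, l)) (eps : R) :
  (2 <= k)%N -> (1 <= l)%N -> 0 < eps ->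
  exists m0 : nat, forall m : nat, (m0 <= m)%N ->
    (fs m F)%:R <= m%:R `^ (3 * k%:R / 2 - 1 + eps).
Proof.
case: k F => // k F k0 l0 eps0.
(* Half of [eps] pays for stopping the iteration after [n] steps; the other half absorbs the
   constant [2 * C], by the choice of [m0]. *)
pose n := Num.truncn (k.+1%:R / eps : R).
have nP : k.+1%:R / (2 * n.+1%:R) <= eps / 2.
  have : k.+1%:R / eps < n.+1%:R by apply: truncnS_gt.
  rewrite ltr_pdivrMr // => lt.
  rewrite ler_pdivrMr ?mulr_gt0 //.
  by rewrite mulrA divfK ?pnatr_eq0 // mulrC ltW.
have [C C0 bound] := shatter_bound_slope R F n k0.
pose m0 := Num.truncn ((2 * C) `^ (2 / eps)).
exists m0.+1 => m mm0.
have m1 : 1 <= m%:R :> R by rewrite ler1n; apply: leq_trans mm0.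
have m0' : 0 < m%:R :> R by apply: lt_le_trans m1.
have Cm : 2 * C <= m%:R `^ (eps / 2).
  have -> : 2 * C = ((2 * C) `^ (2 / eps)) `^ (eps / 2).
    rewrite -powRrM [X in _ `^ X](_ : _ = 1) ?powRr1 ?mulr_ge0 //.
    by field; rewrite gt_eqF.
  apply: ler_powR_base; rewrite ?divr_ge0 ?powR_ge0 // ?ltW //.
  by apply: lt_le_trans (truncnS_gt _) _; rewrite ler_nat.
have [M [sM FM]] := fs_attained m F l0.
have sep : separates (colset M) [set: 'I_m] [set: 'I_(fs m F)].
  move=> x y _ _ /=; rewrite !setIT => /setP exy.
  apply: (injectiveP _ sM); apply/matrixP => r i; rewrite !mxE.
  by have := exy r; rewrite !inE.
have := bound _ _ M FM m%:R _ _ m1 _ sep; rewrite !cardsT !card_ord lexx => /(_ isT).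
set d := threshold _ _ => le; apply: le_trans le _.
have d_lo : k.+1%:R / 2 - eps / 2 <= d by rewrite /d threshold_slope // lerD2l lerN2.
have d_hi : d <= k.+1%:R.
  have : 0 <= k.+1%:R / (2 * n.+1%:R) :> R by rewrite divr_ge0 // mulr_ge0.
  rewrite /d threshold_slope //; move: (k.+1%:R / (2 * _)) => z z0.
  have : 0 <= k.+1%:R :> R by [].
  lra.
have kS : k.+1%:R = k%:R + 1 :> R by rewrite -natr1.
have big : m%:R `^ k%:R <= m%:R `^ (k.+1%:R + (k%:R - d)) :> R.
  by rewrite ler_powR //; lra.
have lev : #|level k.+1 (shattered (colset M) setT setT)|%:R <= m%:R `^ k.+1%:R :> R.
  rewrite powR_mulrn // -natrX ler_nat -[m in (m ^ _)%N]card_ord -cardsT.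
  by apply: card_level_le => S _; apply: subsetT.
apply: le_trans (_ : _ <= C * (2 * m%:R `^ (k.+1%:R + (k%:R - d)))) _.
  rewrite ler_wpM2l // [leRHS]mulr_natl mulr2n lerD // [leRHS]powRD_gt0 //.
  by rewrite ler_wpM2r // powR_ge0.
rewrite mulrA [C * 2]mulrC.
apply: le_trans (ler_wpM2r (powR_ge0 _ _) Cm) _.
rewrite -powRD_gt0 // ler_powR //; lra.
Qed.

Theorem theorem1p3 (R : realType) :
  (forall (l : nat) (F : 'M[bool]_(2, l)), (1 <= l)%N ->
     forall eps : R, 0 < eps ->
     exists m0 : nat, forall m : nat, (m0 <= m)%N ->
       (fs m F)%:R <= m%:R `^ (2 + eps))
  /\
  (forall (k l : nat) (F : 'M[bool]_(k, l)), (3 <= k)%N -> (1 <= l)%N ->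
     forall eps : R, 0 < eps ->
     exists m0 : nat, forall m : nat, (m0 <= m)%N ->
       (fs m F)%:R <= m%:R `^ (5 * k%:R / 3 - 1 + eps)).
Proof.
split=> [l F l0 eps eps0|k l F k3 l0 eps eps0].
  have [m0 m0P] := fs_le_powR F (leqnn 2) l0 eps0.
  exists m0 => m /m0P; congr (_ <= _ `^ _); lra.
have [m0 m0P] := fs_le_powR F (ltnW k3) l0 eps0.
(* Powers of [m] are monotone in the exponent only from [m = 1] on. *)
exists (maxn m0 1) => m; rewrite geq_max => /andP[mm0 m1].
apply: le_trans (m0P m mm0) _; rewrite ler_powR ?ler1n //.
have : 0 <= k%:R :> R by [].
lra.
Qed.
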